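(* In the timely decision problem described in the context, fix $\eta$ and $\nu\in\{0,1\}$. Let $Q^*(\mu,\nu;\eta)=\inf_{\lambda\in\Lambda}Q^*_\lambda(\mu,\nu;\eta)$ and $\bar Q(\mu,\nu;\eta)=\inf_{\hat\theta\in\Theta}\bar Q_{\hat\theta}(\mu,\nu;\eta)$, and let $m_\theta\in\Delta(\Theta)$ denote the vertex (point mass) at $\theta$. Then $\mu\mapsto Q^*(\mu,\nu;\eta)$ is concave on $\Delta(\Theta)$, and $Q^*(m_\theta,\nu;\eta)>\bar Q(m_\theta,\nu;\eta)$ for every $\theta\in\Theta$. Hence the termination set $\mathcal{T}(\eta)=\{\mu\in\Delta(\Theta):Q^*(\mu,\nu;\eta)\ge\bar Q(\mu,\nu;\eta)\}$ is the (disjoint) union of $|\Theta|$ convex regions delimited by the intersection of $Q^*$ and $\bar Q$, and it contains each vertex of the simplex; the (possibly empty) continuation set is its complement $\Delta(\Theta)\setminus\mathcal{T}(\eta)$.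
   Context: $\Theta,\Lambda,\Omega$ finite nonempty; $\Delta(\Theta)$ the simplex. For $\theta\in\Theta,\lambda\in\Lambda$: known distributions $q_{\theta,\lambda}$ on $\Omega$ and $p_{\theta,\lambda}\in(0,1)$. Latent $\theta\sim\mu_0$. Survival $\nu_t$, $\nu_0=1$. At time $t$ with $\nu_t=1$ the agent either commits to a decision $\hat\theta\in\Theta$ (time $\sigma=t$) or performs $\lambda_t\in\Lambda$; given $\theta$, $\nu_{t+1}=0$ w.p. $p_{\theta,\lambda_t}$, else $\nu_{t+1}=1$ and $\omega_{t+1}\sim q_{\theta,\lambda_t}$ is observed. Deadline $\delta=\min\{t:\nu_t=0\}$, $\tau=\min\{\delta,\sigma\}$. Posterior updates: $M(\lambda,\mu,\omega)(\theta)\propto(1-p_{\theta,\lambda})q_{\theta,\lambda}(\omega)\mu(\theta)$ after survival and outcome $\omega$, $\bar M(\lambda,\mu)(\theta)\propto p_{\theta,\lambda}\mu(\theta)$ after death. Costs $c_\lambda>0$; weights $\eta=(\eta_a,\eta_b,\eta_c)$ with positive entries indexed by $\Theta,\Theta,\Lambda$. Loss $\ell=\sum_{\theta'}\eta_{a,\theta'}\mathbf 1\{\theta=\theta',\theta\neq\hat\theta,\tau<\delta\}+\sum_{\theta'}\eta_{b,\theta'}\mathbf 1\{\theta=\theta',\tau=\delta\}+\sum_{t<\tau}\eta_{c,\lambda_t}c_{\lambda_t}$. Strategies map $(\mu_t,\nu_t)$ to distributions on $\Lambda\cup\Theta$; $V^*(\mu,\nu;\eta)$ is the infimum over strategies of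 the expected to-go loss (loss minus already incurred acquisition costs) from posterior $\mu$ and survival state $\nu$. Decision factors: $\bar Q_{\hat\theta}(\mu,\nu;\eta)=(1-\nu)\sum_{\theta'}\eta_{b,\theta'}\mu(\theta')+\nu\sum_{\theta'\neq\hat\theta}\eta_{a,\theta'}\mu(\theta')$. Optimal acquisition factors: $Q^*_\lambda(\mu,\nu;\eta)=(1-\nu)V^*(\mu,0;\eta)+\eta_{c,\lambda}c_\lambda+\nu\big(V^*(\bar M(\lambda,\mu),0;\eta)\sum_{\theta'}p_{\theta',\lambda}\mu(\theta')+\sum_{\omega}V^*(M(\lambda,\mu,\omega),1;\eta)\sum_{\theta'}(1-p_{\theta',\lambda})q_{\theta',\lambda}(\omega)\mu(\theta')\big)$. *)

(* Defs.v *)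
From HB Require Import structures.
From mathcomp Require Import all_boot all_order all_algebra.
From mathcomp Require Import all_classical all_reals all_analysis.
Set Implicit Arguments. Unset Strict Implicit. Unset Printing Implicit Defensive.
Import Order.TTheory GRing.Theory Num.Theory.
Local Open Scope ring_scope.
Local Open Scope classical_set_scope.

Section TDP.
Variables (R : realType) (Th La Om : finType).

Record model := Model {
  q_ : Th -> La -> Om -> R;
  p_ : Th -> La -> R;
  c_ : La -> R }.

Record weights := Weights {
  eta_a : Th -> R;
  eta_b : Th -> R;
  eta_c : La -> R }.

Definition model_wf (D : model) : Prop :=
  [/\ forall th l w, 0 <= q_ D th l w,
      forall th l, \sum_w q_ D th l w = 1,
      forall th l, 0 < p_ D th l < 1
    & forall l, 0 < c_ D l].

Definition weights_pos (e : weights) : Prop :=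
  [/\ forall th, 0 < eta_a e th, forall th, 0 < eta_b e th
    & forall l, 0 < eta_c e l].

Definition belief := Th -> R.

Definition in_simplex (mu : belief) : Prop :=
  (forall th, 0 <= mu th) /\ \sum_th mu th = 1.

Definition vertex (th : Th) : belief := fun th' => (th' == th)%:R.

Definition convcomb (t : R) (mu1 mu2 : belief) : belief :=
  fun th => t * mu1 th + (1 - t) * mu2 th.

(* probability of death / of surviving with outcome w, under belief mu *)
Definition Pdeath (D : model) (l : La) (mu : belief) : R :=
  \sum_th p_ D th l * mu th.
Definition Pobs (D : model) (l : La) (mu : belief) (w : Om) : R :=
  \sum_th (1 - p_ D th l) * q_ D th l w * mu th.

Definition Mupd (D : model) (l : La) (mu : belief) (w : Om) : belief :=
  fun th => (1 - p_ D th l) * q_ D th l w * mu th / Pobs D l mu w.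
Definition Mbar (D : model) (l : La) (mu : belief) : belief :=
  fun th => p_ D th l * mu th / Pdeath D l mu.

Definition Qbar_th (e : weights) (thh : Th) (mu : belief) (nu : bool) : R :=
  (1 - nu%:R) * (\sum_th eta_b e th * mu th)
  + nu%:R * (\sum_(th | th != thh) eta_a e th * mu th).

(* Stationary randomized strategies: (mu, nu) |-> distribution on Lambda + Theta
   (inl l = acquire with action l, inr thh = commit to decision thh). *)
Definition strategy := belief -> bool -> (La + Th)%type -> R.

Definition strategy_ok (s : strategy) : Prop :=
  forall mu nu, (forall a, 0 <= s mu nu a) /\ \sum_a s mu nu a = 1.

(* Expected to-go loss counting only the first n steps of the process
   (paths not terminated within the horizon contribute only their accrued
   acquisition costs).  This is nondecreasing in n and its supremum is the
   expected to-go loss (monotone convergence). *)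
Fixpoint Jn (D : model) (e : weights) (s : strategy) (n : nat)
    (mu : belief) (nu : bool) : R :=
  match n with
  | 0 => 0
  | n'.+1 =>
    if ~~ nu then \sum_th eta_b e th * mu th
    else \sum_(a : (La + Th)%type) s mu nu a *
      match a with
      | inr thh => \sum_(th | th != thh) eta_a e th * mu th
      | inl l => eta_c e l * c_ D l
                 + Pdeath D l mu * Jn D e s n' (Mbar D l mu) false
                 + \sum_w Pobs D l mu w * Jn D e s n' (Mupd D l mu w) true
      end
  end.

Definition Loss (D : model) (e : weights) (s : strategy) (mu : belief)
    (nu : bool) : \bar R :=
  ereal_sup (range (fun n => (Jn D e s n mu nu)%:E)).

Definition Vstar (D : model) (e : weights) (mu : belief) (nu : bool) : \bar R :=
  ereal_inf [set Loss D e s mu nu | s in strategy_ok].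

Definition Qstar_l (D : model) (e : weights) (l : La) (mu : belief)
    (nu : bool) : \bar R :=
  ((1 - nu%:R)%:E * Vstar D e mu false + (eta_c e l * c_ D l)%:E
   + (nu%:R)%:E * ((Pdeath D l mu)%:E * Vstar D e (Mbar D l mu) false
      + \sum_w (Pobs D l mu w)%:E * Vstar D e (Mupd D l mu w) true))%E.

Definition Qstar (D : model) (e : weights) (mu : belief) (nu : bool) : \bar R :=
  ereal_inf (range (fun l => Qstar_l D e l mu nu)).

Definition Qbar (e : weights) (mu : belief) (nu : bool) : \bar R :=
  ereal_inf (range (fun thh => (Qbar_th e thh mu nu)%:E)).

Definition Tset (D : model) (e : weights) (nu : bool) : set belief :=
  [set mu | in_simplex mu /\ (Qbar e mu nu <= Qstar D e mu nu)%E].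

Definition Treg (D : model) (e : weights) (nu : bool) (thh : Th) : set belief :=
  [set mu | in_simplex mu /\ ((Qbar_th e thh mu nu)%:E <= Qstar D e mu nu)%E].

Definition Cset (D : model) (e : weights) (nu : bool) : set belief :=
  [set mu | in_simplex mu] `\` Tset D e nu.

End TDP.

(* Main.v *)
(* The optimal value is the increasing limit of value iteration V_n, and the
   greedy strategy for that limit attains it, so V* = lim V_n.  Each Bellman
   step preserves concavity in the belief: the expected continuation value
   sum_w P(w | mu) V(M(l, mu, w)) is a sum of perspectives u |-> |u| V(u / |u|)
   of V at linear images u of mu, and the perspective of a concave function is
   concave (it is positively homogeneous and superadditive); minima and limits of
   concave functions are concave.  Hence Q* = min_l Q*_l is concave, so each
   region where a linear decision factor lies below Q* is convex.  At the vertex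
   m_th, deciding th costs nothing (nu = 1) or exactly the deadline loss
   (nu = 0), whereas any acquisition pays eta_c c_l > 0 on top of that. *)

Require Import Defs.
From HB Require Import structures.
From mathcomp Require Import all_boot all_order all_algebra.
From mathcomp Require Import all_classical all_reals all_analysis.
From mathcomp Require Import ring.
Import Order.TTheory GRing.Theory Num.Theory numFieldNormedType.Exports.
Local Open Scope ring_scope.
Local Open Scope classical_set_scope.
Set Implicit Arguments. Unset Strict Implicit. Unset Printing Implicit Defensive.

Section ArgMin.
Variables (R : realType) (I : finType) (i0 : I).

Lemma arg_min_le (f : I -> R) j : f [arg min_(i < i0) f i]%O <= f j.
Proof. by case: arg_minP => // i _; apply. Qed.

Lemma ereal_inf_range_arg_min (f : I -> R) :
  ereal_inf (range (fun i => (f i)%:E)) = (f [arg min_(i < i0) f i]%O)%:E.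
Proof.
apply/eqP; rewrite eq_le; apply/andP; split.
  by apply: ereal_inf_lbound; exists [arg min_(i < i0) f i]%O.
by apply: le_ereal_inf_tmp => _ [j _ <-]; rewrite lee_fin arg_min_le.
Qed.

End ArgMin.

Section Concavity.
Variables (R : realType) (Th : finType).
Implicit Types (mu u : belief R Th) (V : belief R Th -> R) (t : R).

Definition nonneg mu := forall th, 0 <= mu th.

(* Concavity on the whole nonnegative orthant, not only on the simplex: the
   perspective argument evaluates V at unnormalised beliefs, and a posterior
   after an outcome of probability 0 is the zero vector. *)
Definition concave V := forall mu1 mu2 t,
  nonneg mu1 -> nonneg mu2 -> 0 <= t <= 1 ->
  t * V mu1 + (1 - t) * V mu2 <= V (convcomb t mu1 mu2).

Lemma sum_convcomb (P : pred Th) (g : Th -> R) t mu1 mu2 :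
  \sum_(th | P th) g th * convcomb t mu1 mu2 th =
  t * \sum_(th | P th) g th * mu1 th + (1 - t) * \sum_(th | P th) g th * mu2 th.
Proof.
by rewrite !mulr_sumr -big_split; apply: eq_bigr => th _ /=; rewrite /convcomb; ring.
Qed.

Lemma weighted_sum_ge0 (P : pred Th) (g : Th -> R) mu :
  (forall th, 0 <= g th) -> nonneg mu -> 0 <= \sum_(th | P th) g th * mu th.
Proof. by move=> g0 mu0; apply: sumr_ge0 => th _; rewrite mulr_ge0. Qed.

Lemma convcomb_nonneg t mu1 mu2 : nonneg mu1 -> nonneg mu2 -> 0 <= t <= 1 ->
  nonneg (convcomb t mu1 mu2).
Proof. by move=> h1 h2 /andP[t0 t1] th; rewrite addr_ge0 ?mulr_ge0 ?subr_ge0. Qed.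

Lemma concave_linear (P : pred Th) (g : Th -> R) :
  concave (fun mu => \sum_(th | P th) g th * mu th).
Proof. by move=> mu1 mu2 t _ _ _; rewrite sum_convcomb. Qed.

Lemma concave_cst (c : R) : concave (fun=> c).
Proof. by move=> mu1 mu2 t _ _ _; rewrite -mulrDl subrKC mul1r. Qed.

Lemma concave_add V W : concave V -> concave W -> concave (fun mu => V mu + W mu).
Proof.
move=> cV cW mu1 mu2 t h1 h2 ht.
apply: le_trans (lerD (cV _ _ _ h1 h2 ht) (cW _ _ _ h1 h2 ht)).
by rewrite le_eqVlt; apply/orP; left; apply/eqP; ring.
Qed.

Lemma concave_scale (c : R) V : 0 <= c -> concave V -> concave (fun mu => c * V mu).
Proof.
move=> c0 cV mu1 mu2 t h1 h2 ht; rewrite mulrCA [(1 - t) * _]mulrCA -mulrDr.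
exact/ler_wpM2l/cV.
Qed.

Lemma concave_sum (I : finType) (V : I -> belief R Th -> R) :
  (forall i, concave (V i)) -> concave (fun mu => \sum_i V i mu).
Proof.
move=> cV mu1 mu2 t h1 h2 ht; rewrite !mulr_sumr -big_split.
by apply: ler_sum => i _; exact: cV.
Qed.

Lemma concave_arg_min (I : finType) (i0 : I) (V : I -> belief R Th -> R) :
  (forall i, concave (V i)) -> concave (fun mu => V [arg min_(i < i0) V i mu]%O mu).
Proof.
move=> cV mu1 mu2 t h1 h2 /[dup] ht /andP[t0 t1].
apply: le_trans (cV _ _ _ _ h1 h2 ht).
by apply: lerD; apply: ler_wpM2l; rewrite ?subr_ge0 //; exact: (arg_min_le i0 (V ^~ _)).
Qed.

Lemma concave_lim (V : nat -> belief R Th -> R) (W : belief R Th -> R) :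
  (forall n, concave (V n)) -> (forall mu, nonneg mu -> (fun n => V n mu) @ \oo --> W mu) ->
  concave W.
Proof.
move=> cV VW mu1 mu2 t h1 h2 ht.
apply: (ler_cvg_to _ (VW _ (convcomb_nonneg h1 h2 ht))); last by near=> n; exact: cV.
by apply: cvgD; apply: cvgM; [exact: cvg_cst | exact: VW | exact: cvg_cst | exact: VW].
Unshelve. all: by end_near. Qed.

Lemma simplex_nonneg mu : in_simplex mu -> nonneg mu.
Proof. by case. Qed.

Lemma simplex_convcomb t mu1 mu2 : in_simplex mu1 -> in_simplex mu2 -> 0 <= t <= 1 ->
  in_simplex (convcomb t mu1 mu2).
Proof.
move=> [h1 s1] [h2 s2] ht; split; first exact: convcomb_nonneg.
by rewrite /convcomb big_split /= -!mulr_sumr s1 s2 !mulr1 subrKC.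
Qed.

Lemma vertex_simplex (th : Th) : in_simplex (vertex R th).
Proof.
split=> [th'|]; first exact: ler0n.
by rewrite (bigD1 th) //= /vertex eqxx big1 ?addr0 // => th' /negbTE ->.
Qed.

Definition mass u := \sum_th u th.
Definition normalize u : belief R Th := fun th => u th / mass u.
Definition persp V u := mass u * V (normalize u).

Lemma mass_ge0 u : nonneg u -> 0 <= mass u.
Proof. by move=> u0; apply: sumr_ge0. Qed.

Lemma normalize_nonneg u : nonneg u -> nonneg (normalize u).
Proof. by move=> u0 th; rewrite divr_ge0 ?mass_ge0. Qed.

Lemma mass_eq0 u : nonneg u -> mass u = 0 -> u = fun=> 0.
Proof.
move=> u0 /eqP; rewrite psumr_eq0 => [/allP u_eq0|th _ //].
by apply: funext => th; apply/eqP/u_eq0; rewrite mem_index_enum.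
Qed.

Lemma persp0 V : persp V (fun=> 0) = 0.
Proof. by rewrite /persp /mass big1 ?mul0r. Qed.

Lemma perspZ V (c : R) u : 0 <= c -> persp V (fun th => c * u th) = c * persp V u.
Proof.
rewrite le_eqVlt => /predU1P[<-|c0].
  by rewrite mul0r; under eq_fun do rewrite mul0r; exact: persp0.
rewrite /persp; have -> : normalize (fun th => c * u th) = normalize u.
  apply: funext => th; rewrite /normalize /mass -mulr_sumr invfM.
  by rewrite mulrACA divff ?gt_eqF // mul1r.
by rewrite /mass -mulr_sumr mulrA.
Qed.

Lemma persp_add V u1 u2 : concave V -> nonneg u1 -> nonneg u2 ->
  persp V u1 + persp V u2 <= persp V (fun th => u1 th + u2 th).
Proof.
move=> cV h1 h2; have [m1_0|m1_neq0] := eqVneq (mass u1) 0.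
  rewrite (mass_eq0 h1 m1_0) persp0 add0r.
  by rewrite (_ : (fun th => 0 + u2 th) = u2) //; apply: funext => th; rewrite add0r.
have [m2_0|m2_neq0] := eqVneq (mass u2) 0.
  rewrite (mass_eq0 h2 m2_0) persp0 addr0.
  by rewrite (_ : (fun th => u1 th + 0) = u1) //; apply: funext => th; rewrite addr0.
have m1_gt0 : 0 < mass u1 by rewrite lt_def m1_neq0 mass_ge0.
have m2_gt0 : 0 < mass u2 by rewrite lt_def m2_neq0 mass_ge0.
have S_gt0 := addr_gt0 m1_gt0 m2_gt0.
have mass_add : mass (fun th => u1 th + u2 th) = mass u1 + mass u2.
  by rewrite /mass big_split.
set lam := mass u1 / (mass u1 + mass u2).
have lam01 : 0 <= lam <= 1.
  apply/andP; split; first exact: divr_ge0 (ltW m1_gt0) (ltW S_gt0).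
  by rewrite /lam ler_pdivrMr // mul1r lerDl ltW.
rewrite /persp mass_add.
have -> : normalize (fun th => u1 th + u2 th) = convcomb lam (normalize u1) (normalize u2).
  apply: funext => th; rewrite /normalize /convcomb mass_add /lam.
  by field; rewrite m1_neq0 m2_neq0 gt_eqF.
have := cV _ _ _ (normalize_nonneg h1) (normalize_nonneg h2) lam01.
move/(ler_wpM2l (ltW S_gt0)); apply: le_trans.
by rewrite le_eqVlt; apply/orP; left; apply/eqP; rewrite /lam; field; rewrite gt_eqF.
Qed.

Lemma concave_persp V (g : Th -> R) : concave V -> (forall th, 0 <= g th) ->
  concave (fun mu => persp V (fun th => g th * mu th)).
Proof.
move=> cV g0 mu1 mu2 t h1 h2 /andP[t0 t1].
have -> : (fun th => g th * convcomb t mu1 mu2 th) =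
    (fun th => t * (g th * mu1 th) + (1 - t) * (g th * mu2 th)).
  by apply: funext => th; rewrite /convcomb; ring.
rewrite -perspZ // -[(1 - t) * _]perspZ ?subr_ge0 //.
by apply: persp_add => // th; rewrite !mulr_ge0 ?subr_ge0.
Qed.

End Concavity.

Section Value.
Variables (R : realType) (Th La Om : finType).
Variables (D : model R Th La Om) (e : weights R Th La) (th0 : Th) (l0 : La).
Hypotheses (D_wf : model_wf D) (e_pos : weights_pos e).
Implicit Types (mu x : belief R Th) (V W : belief R Th -> bool -> R).

Let p_ge0 th l : 0 <= p_ D th l.
Proof. by case: D_wf => _ _ /(_ th l)/andP[/ltW]. Qed.

Let survival_ge0 th l w : 0 <= (1 - p_ D th l) * q_ D th l w.
Proof.
by case: D_wf => q_ge0 _ /(_ th l)/andP[_ p_lt1] _; rewrite mulr_ge0 // subr_ge0 ltW.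
Qed.

Let eta_a_ge0 th : 0 <= eta_a e th. Proof. by case: e_pos => /(_ th)/ltW. Qed.
Let eta_b_ge0 th : 0 <= eta_b e th. Proof. by case: e_pos => _ /(_ th)/ltW. Qed.
Let cost_gt0 l : 0 < eta_c e l * c_ D l.
Proof.
by case: e_pos => _ _ /(_ l) eta_c_gt0; case: D_wf => _ _ _ /(_ l); exact: mulr_gt0.
Qed.

Lemma Pdeath_ge0 l mu : nonneg mu -> 0 <= Pdeath D l mu.
Proof. exact: weighted_sum_ge0. Qed.

Lemma Pobs_ge0 l mu w : nonneg mu -> 0 <= Pobs D l mu w.
Proof. exact: weighted_sum_ge0. Qed.

Lemma Mbar_nonneg l mu : nonneg mu -> nonneg (Mbar D l mu).
Proof. by move=> mu0; apply: normalize_nonneg => th; rewrite mulr_ge0. Qed.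

Lemma Mupd_nonneg l mu w : nonneg mu -> nonneg (Mupd D l mu w).
Proof. by move=> mu0; apply: normalize_nonneg => th; rewrite mulr_ge0. Qed.

Definition continuation V l mu :=
  Pdeath D l mu * V (Mbar D l mu) false
  + \sum_w Pobs D l mu w * V (Mupd D l mu w) true.

Definition action_loss V (a : La + Th) mu : R :=
  match a with
  | inl l => eta_c e l * c_ D l + continuation V l mu
  | inr thh => \sum_(th | th != thh) eta_a e th * mu th
  end.

Definition greedy V mu : La + Th := [arg min_(a < inr th0) action_loss V a mu]%O.

(* Value iteration for the truncated losses [Jn]; [th0] only serves as the
   default of the arg min. *)
Fixpoint Vn n mu nu : R :=
  if n is n'.+1 then
    if nu then action_loss (Vn n') (greedy (Vn n') mu) mu
    else \sum_th eta_b e th * mu th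
  else 0.

Definition Vlim mu nu := sup (range (fun n => Vn n mu nu)).

Definition le_on_nonneg V W := forall x nu, nonneg x -> V x nu <= W x nu.

Lemma continuation_le V W l mu : le_on_nonneg V W -> nonneg mu ->
  continuation V l mu <= continuation W l mu.
Proof.
move=> VW mu0; apply: lerD.
  by apply: ler_wpM2l; [exact: Pdeath_ge0 | exact/VW/Mbar_nonneg].
by apply: ler_sum => w _; apply: ler_wpM2l; [exact: Pobs_ge0 | exact/VW/Mupd_nonneg].
Qed.

Lemma continuation_ge0 V l mu : (forall x nu, nonneg x -> 0 <= V x nu) -> nonneg mu ->
  0 <= continuation V l mu.
Proof.
move=> V0 mu0; apply: addr_ge0.
  by apply: mulr_ge0; [exact: Pdeath_ge0 | exact/V0/Mbar_nonneg].
by apply: sumr_ge0 => w _; apply: mulr_ge0; [exact: Pobs_ge0 | exact/V0/Mupd_nonneg].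
Qed.

Lemma action_loss_le V W a mu : le_on_nonneg V W -> nonneg mu ->
  action_loss V a mu <= action_loss W a mu.
Proof. by case: a => [l|thh] //= VW mu0; rewrite lerD2l continuation_le. Qed.

Lemma action_loss_ge0 V a mu : (forall x nu, nonneg x -> 0 <= V x nu) -> nonneg mu ->
  0 <= action_loss V a mu.
Proof.
case: a => [l|thh] /= V0 mu0; last exact: weighted_sum_ge0.
by rewrite addr_ge0 ?(ltW (cost_gt0 l)) ?continuation_ge0.
Qed.

Lemma greedy_le V a mu : action_loss V (greedy V mu) mu <= action_loss V a mu.
Proof. exact: (arg_min_le _ (action_loss V ^~ mu)). Qed.

Lemma greedy_loss_le V W mu : le_on_nonneg V W -> nonneg mu ->
  action_loss V (greedy V mu) mu <= action_loss W (greedy W mu) mu.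
Proof. by move=> VW mu0; apply: le_trans (greedy_le _ _ _) (action_loss_le _ VW mu0). Qed.

Lemma Vn_ge0 n mu nu : nonneg mu -> 0 <= Vn n mu nu.
Proof.
elim: n mu nu => [//|n IH] mu [|] mu0 /=; last exact: weighted_sum_ge0.
by apply: action_loss_ge0.
Qed.

Lemma Vn_le_sum n mu nu : nonneg mu ->
  Vn n mu nu <= \sum_th eta_a e th * mu th + \sum_th eta_b e th * mu th.
Proof.
move=> mu0; case: n => [|n /=]; first by rewrite addr_ge0 ?weighted_sum_ge0.
case: nu; last by rewrite lerDr weighted_sum_ge0.
apply: le_trans (greedy_le _ (inr th0) _) _.
rewrite [\sum_th _](bigID (fun th => th != th0)) /= -addrA lerDl.
by rewrite addr_ge0 ?weighted_sum_ge0.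
Qed.

Lemma Vn_leS n mu nu : nonneg mu -> Vn n mu nu <= Vn n.+1 mu nu.
Proof.
elim: n mu nu => [|n IH] mu nu mu0; first exact: Vn_ge0.
by case: nu => //=; apply: greedy_loss_le => // x nu x0; exact: IH.
Qed.

Lemma Vn_has_sup mu nu : nonneg mu -> has_sup (range (fun n => Vn n mu nu)).
Proof.
move=> mu0; split; first by exists (Vn 0 mu nu), 0%N.
by eexists => _ [n _ <-]; exact: Vn_le_sum.
Qed.

Lemma Vn_le_Vlim n mu nu : nonneg mu -> Vn n mu nu <= Vlim mu nu.
Proof. by move=> mu0; apply: sup_upper_bound (Vn_has_sup nu mu0) _ _; exists n. Qed.

Lemma Vn_cvg mu nu : nonneg mu -> (fun n => Vn n mu nu) @ \oo --> Vlim mu nu.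
Proof.
move=> mu0; apply: nondecreasing_cvgn; last by case: (Vn_has_sup nu mu0).
by apply/nondecreasing_seqP => n; exact: Vn_leS.
Qed.

Lemma Vlim_ge0 mu nu : nonneg mu -> 0 <= Vlim mu nu.
Proof. exact: (Vn_le_Vlim 0). Qed.

Lemma Vlim_false mu : nonneg mu -> Vlim mu false = \sum_th eta_b e th * mu th.
Proof.
move=> mu0; apply: le_anti; apply/andP; split; last exact: (Vn_le_Vlim 1 false mu0).
apply: ge_sup; first by exists (Vn 0 mu false), 0%N.
by move=> _ [[|n] _ <-] //=; exact: weighted_sum_ge0.
Qed.

Lemma action_loss_cvg a mu : nonneg mu ->
  (fun n => action_loss (Vn n) a mu) @ \oo --> action_loss Vlim a mu.
Proof.
case: a => [l|thh] mu0 /=; last exact: cvg_cst.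
apply: cvgD; first exact: cvg_cst.
apply: cvgD; first by apply: cvgM; [exact: cvg_cst | apply: Vn_cvg; exact: Mbar_nonneg].
apply: cvg_big => [|w _]; first exact: add_continuous.
by apply: cvgM; [exact: cvg_cst | apply: Vn_cvg; exact: Mupd_nonneg].
Qed.

(* Only finitely many posteriors enter [action_loss], so [Vn n] approaches
   [Vlim] uniformly on them. *)
Lemma greedy_Vlim_le mu : nonneg mu ->
  action_loss Vlim (greedy Vlim mu) mu <= Vlim mu true.
Proof.
move=> mu0; apply/ler_addgt0Pr => eps eps_gt0.
have [N _ loss_near] : \forall n \near \oo,
    forall a, action_loss Vlim a mu - eps < action_loss (Vn n) a mu.
  apply: filter_forall => a; apply: cvgr_gt; first exact: action_loss_cvg.
  by rewrite ltrBlDr ltrDl.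
have /ltW := loss_near N (leqnn N) (greedy (Vn N) mu); rewrite lerBlDr => loss_le.
apply: le_trans (greedy_le _ _ _) (le_trans loss_le _).
by rewrite lerD2r; exact: (Vn_le_Vlim N.+1 true mu0).
Qed.

Lemma Jn_succ_true s n mu :
  Jn D e s n.+1 mu true = \sum_a s mu true a * action_loss (Jn D e s n) a mu.
Proof. by apply: eq_bigr => -[l|thh] _ //=; rewrite /continuation addrA. Qed.

Lemma Vn_le_Jn s n mu nu : strategy_ok s -> nonneg mu -> Vn n mu nu <= Jn D e s n mu nu.
Proof.
move=> s_ok; elim: n mu nu => [//|n IH] mu [] mu0 //.
have [s_ge0 s_sum1] := s_ok mu true.
rewrite Jn_succ_true -[Vn _ _ _]mul1r -s_sum1 mulr_suml.
apply: ler_sum => a _; apply: ler_wpM2l => //.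
apply: le_trans (greedy_le _ a _) (action_loss_le _ _ mu0) => x nu x0; exact: IH.
Qed.

Definition greedy_strategy : strategy R Th La := fun mu _ a => (a == greedy Vlim mu)%:R.

Lemma sum_greedy_strategy (F : La + Th -> R) mu nu :
  \sum_a greedy_strategy mu nu a * F a = F (greedy Vlim mu).
Proof.
rewrite (bigD1 (greedy Vlim mu)) //= /greedy_strategy eqxx mul1r big1 ?addr0 //.
by move=> a /negbTE ->; rewrite mul0r.
Qed.

Lemma greedy_strategy_ok : strategy_ok greedy_strategy.
Proof.
move=> mu nu; split=> [a|]; first exact: ler0n.
by have := sum_greedy_strategy (fun=> 1) mu nu; under eq_bigr do rewrite mulr1.
Qed.

Lemma Jn_greedy_le n mu nu : nonneg mu -> Jn D e greedy_strategy n mu nu <= Vlim mu nu.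
Proof.
elim: n mu nu => [|n IH] mu nu mu0; first exact: Vlim_ge0.
case: nu; last by rewrite Vlim_false.
rewrite Jn_succ_true sum_greedy_strategy; apply: le_trans (greedy_Vlim_le mu0).
by apply: action_loss_le => // x nu x0; exact: IH.
Qed.

Lemma Vstar_Vlim mu nu : nonneg mu -> Vstar D e mu nu = (Vlim mu nu)%:E.
Proof.
move=> mu0; apply/eqP; rewrite eq_le; apply/andP; split.
  apply: (@le_trans _ _ (Loss D e greedy_strategy mu nu)).
    by apply: ereal_inf_lbound; exists greedy_strategy => //; exact: greedy_strategy_ok.
  by apply: ge_ereal_sup => _ [n _ <-]; rewrite lee_fin Jn_greedy_le.
apply: le_ereal_inf_tmp => _ [s s_ok <-].
have [Vn_ne Vn_ub] := Vn_has_sup nu mu0.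
rewrite /Vlim -ereal_sup_EFin //; apply: ge_ereal_sup => _ [_ [n _ <-] <-].
apply: le_trans (_ : (Jn D e s n mu nu)%:E <= _)%E; first by rewrite lee_fin Vn_le_Jn.
by apply: ereal_sup_ubound; exists n.
Qed.

Lemma continuation_concave V l : (forall nu, concave (V ^~ nu)) ->
  concave (continuation V l).
Proof.
move=> V_concave.
have -> : continuation V l = fun mu =>
    persp (V ^~ false) (fun th => p_ D th l * mu th)
    + \sum_w persp (V ^~ true) (fun th => (1 - p_ D th l) * q_ D th l w * mu th) by [].
apply: concave_add; first exact: concave_persp.
by apply: concave_sum => w; exact: concave_persp.
Qed.

Lemma action_loss_concave V a : (forall nu, concave (V ^~ nu)) ->
  concave (action_loss V a).
Proof.
case: a => [l|thh] V_concave; last exact: concave_linear.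
by apply: concave_add; [exact: concave_cst | exact: continuation_concave].
Qed.

Lemma Vn_concave n nu : concave (Vn n ^~ nu).
Proof.
elim: n nu => [|n IH] nu; first exact: concave_cst.
case: nu => /=; last exact: concave_linear.
apply: (concave_arg_min (inr th0) (V := action_loss (Vn n))) => a.
exact: action_loss_concave.
Qed.

Lemma Vlim_concave nu : concave (Vlim ^~ nu).
Proof. by apply: (concave_lim (Vn_concave ^~ nu)) => mu; exact: Vn_cvg. Qed.

Definition Qreal_l (nu : bool) l mu : R :=
  (1 - nu%:R) * Vlim mu false + eta_c e l * c_ D l + nu%:R * continuation Vlim l mu.

Lemma Qstar_l_EFin l mu nu : nonneg mu ->
  Qstar_l D e l mu nu = (Qreal_l nu l mu)%:E.
Proof.
move=> mu0; have Mbar0 := Mbar_nonneg l mu0.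
rewrite /Qstar_l /Qreal_l /continuation !Vstar_Vlim //.
rewrite (eq_bigr (fun w => (Pobs D l mu w * Vlim (Mupd D l mu w) true)%:E)); last first.
  by move=> w _; rewrite Vstar_Vlim //; exact: Mupd_nonneg.
by rewrite sumEFin -!EFinM -!EFinD.
Qed.

Lemma Qreal_l_concave nu l : concave (Qreal_l nu l).
Proof.
have nu_le1 : 0 <= 1 - nu%:R :> R by case: nu; rewrite ?subrr ?subr0.
have nu_ge0 : 0 <= nu%:R :> R by exact: ler0n.
apply: concave_add; last exact/concave_scale/continuation_concave/Vlim_concave.
by apply: concave_add; [exact/concave_scale/Vlim_concave | exact: concave_cst].
Qed.

Lemma Qbar_th_lt_Qreal_l_vertex th l nu :
  Qbar_th e th (vertex R th) nu < Qreal_l nu l (vertex R th).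
Proof.
have v0 : nonneg (vertex R th) by move=> th'; exact: ler0n.
case: nu; rewrite /Qbar_th /Qreal_l /= ?subrr ?subr0 !(mul0r, mul1r, add0r, addr0).
  rewrite big1 => [|th' /negbTE]; last by rewrite /vertex => ->; rewrite mulr0.
  by rewrite ltr_pwDl ?continuation_ge0 // => x nu x0; exact: Vlim_ge0.
by rewrite Vlim_false // ltrDl.
Qed.

Definition Qreal nu mu := Qreal_l nu [arg min_(l < l0) Qreal_l nu l mu]%O mu.

Lemma Qstar_EFin mu nu : nonneg mu -> Qstar D e mu nu = (Qreal nu mu)%:E.
Proof.
move=> mu0; rewrite /Qstar (_ : (fun l => _) = (fun l => (Qreal_l nu l mu)%:E)).
  exact: ereal_inf_range_arg_min.
by apply: funext => l; exact: Qstar_l_EFin.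
Qed.

Lemma Qreal_concave nu : concave (Qreal nu).
Proof. exact/concave_arg_min/Qreal_l_concave. Qed.

End Value.

Section Termination.
Variables (R : realType) (Th La Om : finType).
Variables (D : model R Th La Om) (e : weights R Th La) (th0 : Th) (l0 : La).
Hypotheses (D_wf : model_wf D) (e_pos : weights_pos e).
Implicit Types (mu : belief R Th) (nu : bool).

Lemma Qbar_le_Qbar_th thh mu nu : (Qbar e mu nu <= (Qbar_th e thh mu nu)%:E)%E.
Proof. by apply: ereal_inf_lbound; exists thh. Qed.

Lemma Qbar_th_convcomb thh nu t mu1 mu2 :
  Qbar_th e thh (convcomb t mu1 mu2) nu =
  t * Qbar_th e thh mu1 nu + (1 - t) * Qbar_th e thh mu2 nu.
Proof. by rewrite /Qbar_th !sum_convcomb; ring. Qed.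

Lemma Qstar_concave nu mu1 mu2 t : in_simplex mu1 -> in_simplex mu2 -> 0 <= t <= 1 ->
  (t%:E * Qstar D e mu1 nu + (1 - t)%:E * Qstar D e mu2 nu
     <= Qstar D e (convcomb t mu1 mu2) nu)%E.
Proof.
move=> /simplex_nonneg h1 /simplex_nonneg h2 ht.
rewrite !(Qstar_EFin th0 l0 D_wf e_pos) //; last exact: convcomb_nonneg.
rewrite -EFinM -EFinM -EFinD lee_fin; exact: Qreal_concave.
Qed.

Lemma Qbar_th_lt_Qstar_vertex th nu :
  ((Qbar_th e th (vertex R th) nu)%:E < Qstar D e (vertex R th) nu)%E.
Proof.
rewrite (Qstar_EFin th0 l0 D_wf e_pos) ?lte_fin; last exact/simplex_nonneg/vertex_simplex.
exact: Qbar_th_lt_Qreal_l_vertex.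
Qed.

Lemma Qbar_lt_Qstar_vertex th nu :
  (Qbar e (vertex R th) nu < Qstar D e (vertex R th) nu)%E.
Proof. exact: le_lt_trans (Qbar_le_Qbar_th th _ _) (Qbar_th_lt_Qstar_vertex _ _). Qed.

Lemma Treg_vertex nu th : Treg D e nu th (vertex R th).
Proof. by split; [exact: vertex_simplex | exact/ltW/Qbar_th_lt_Qstar_vertex]. Qed.

Lemma Tset_bigcup nu : Tset D e nu = \bigcup_(thh in [set: Th]) Treg D e nu thh.
Proof.
apply/seteqP; split=> mu /=.
  move=> [mu_simplex]; rewrite /Qbar (ereal_inf_range_arg_min th0) => Qbar_le.
  by exists [arg min_(thh < th0) Qbar_th e thh mu nu]%O.
move=> [thh _ [mu_simplex Qbar_th_le]]; split=> //.
exact: le_trans (Qbar_le_Qbar_th _ _ _) Qbar_th_le.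
Qed.

Lemma Treg_convex nu thh mu1 mu2 t :
  Treg D e nu thh mu1 -> Treg D e nu thh mu2 -> 0 <= t <= 1 ->
  Treg D e nu thh (convcomb t mu1 mu2).
Proof.
move=> [s1 le1] [s2 le2] /[dup] ht /andP[t0 t1]; split; first exact: simplex_convcomb.
apply: le_trans (Qstar_concave _ s1 s2 ht); rewrite Qbar_th_convcomb EFinD !EFinM.
by apply: leeD; apply: lee_wpmul2l; rewrite ?lee_fin ?subr_ge0.
Qed.

Lemma Tset_vertex nu th : Tset D e nu (vertex R th).
Proof. by rewrite Tset_bigcup; exists th => //; exact: Treg_vertex. Qed.

End Termination.

Theorem proposition4 (R : realType) (Th La Om : finType)
    (D : model R Th La Om) (e : weights R Th La) (nu : bool) :
  (0 < #|Th|)%N -> (0 < #|La|)%N -> (0 < #|Om|)%N ->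
  model_wf D -> weights_pos e ->
  [/\ (* concavity of mu |-> Q*(mu, nu; eta) on the simplex *)
      (forall (mu1 mu2 : belief R Th) (t : R),
         in_simplex mu1 -> in_simplex mu2 -> 0 <= t <= 1 ->
         (t%:E * Qstar D e mu1 nu + (1 - t)%:E * Qstar D e mu2 nu
            <= Qstar D e (convcomb t mu1 mu2) nu)%E),
      (* strict inequality at the vertices *)
      (forall th : Th, (Qbar e (vertex R th) nu < Qstar D e (vertex R th) nu)%E),
      (* T(eta) is the union of the |Theta| regions T_thh(eta) ... *)
      Tset D e nu = \bigcup_(thh in [set: Th]) Treg D e nu thh,
      (* ... each of which is convex and contains its vertex ... *)
      (forall thh : Th,
         Treg D e nu thh (vertex R thh) /\
         forall (mu1 mu2 : belief R Th) (t : R),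
           Treg D e nu thh mu1 -> Treg D e nu thh mu2 -> 0 <= t <= 1 ->
           Treg D e nu thh (convcomb t mu1 mu2))
    & (* T(eta) contains every vertex *)
      (forall th : Th, Tset D e nu (vertex R th))].
Proof.
move=> /card_gt0P[th0 _] /card_gt0P[l0 _] _ D_wf e_pos.
split=> [mu1 mu2 t|th|||th].
- exact: Qstar_concave.
- exact: Qbar_lt_Qstar_vertex.
- exact: Tset_bigcup.
- move=> thh; split=> [|mu1 mu2 t]; [exact: Treg_vertex | exact: Treg_convex].
- exact: Tset_vertex.
Qed.
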